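(* Let $n\ge 1$. Define a map $\Psi_n$ on $\mathcal{B}_n$ by $\Psi_n(p_n)=q_n$, where $$q_n(X,Y)=p_n(X+iY,\,X-iY)\quad\text{if } n \text{ is even},$$ $$q_n(X,Y)=p_n\big(\epsilon(X+iY),\,\epsilon(X-iY)\big),\quad \epsilon=e^{\pi i/(2(n+1))},\quad\text{if } n \text{ is odd}.$$ Then $\Psi_n$ is an isomorphism (of real vector spaces) from $\mathcal{B}_n$ onto $\mathcal{F}_n$.
   Context: $\mathcal{B}_n$ is the real vector space of all complex binary forms $$p_n(T,U)=\sum_{k=0}^{n+1}\zeta_kT^{n+1-k}U^k,\qquad \zeta_k\in\mathbb{C},\quad \zeta_k=(-1)^n\,\overline{\zeta_{n+1-k}}\ \ (k=0,\dots,n+1).$$ $\mathcal{F}_n$ is the real vector space of all real binary forms $\sum_{j=0}^{n+1}b_jX^{n+1-j}Y^j$ with $b_0,\dots,b_{n+1}\in\mathbb{R}$ (it is not assumed that $b_0\ne0$). Here $i=\sqrt{-1}$. *)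

(* Defs.v *)
From HB Require Import structures.
From mathcomp Require Import all_boot all_order all_algebra.
From mathcomp Require Import complex mpoly.
From mathcomp Require Import reals sequences trigo.

Set Implicit Arguments.
Unset Strict Implicit.
Unset Printing Implicit Defensive.

Import Order.TTheory GRing.Theory Num.Theory.

Local Open Scope ring_scope.
Local Open Scope complex_scope.

(* The exponent of T^(d-k) U^k, where T (or X) is the variable of index 0     *)
(* and U (or Y) the one of index 1.                                           *)
Definition bimonom (d k : nat) : 'X_{1..2} :=
  (U_(ord0) *+ (d - k) + U_(ord_max) *+ k)%MM.

Definition cexp (R : realType) (z : R[i]) : R[i] :=
  (expR (complex.Re z))%:C * (cos (complex.Im z) +i* sin (complex.Im z)).

Lemma bimonom0 d k : bimonom d k ord0 = (d - k)%N.
Proof. by rewrite /bimonom mnmDE !mulmnE !mnm1E /= ?(muln1, muln0, mul1n, mul0n, addn0, add0n). Qed.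

Lemma bimonom1 d k : bimonom d k ord_max = k.
Proof. by rewrite /bimonom mnmDE !mulmnE !mnm1E /= ?(muln1, muln0, mul1n, mul0n, addn0, add0n). Qed.

Lemma mdeg_bimonom d k : (k <= d)%N -> mdeg (bimonom d k) = d.
Proof.
by move=> kd; rewrite mdegE big_ord_recr big_ord1 /= bimonom1
  (_ : widen_ord _ _ = ord0) ?bimonom0 ?subnK //; apply/val_inj.
Qed.

Lemma bimonomK d (m : 'X_{1..2}) : mdeg m = d -> bimonom d (m ord_max) = m.
Proof.
have w : widen_ord (leqnSn 1) ord0 = ord0 by apply/val_inj.
rewrite mdegE big_ord_recr big_ord1 /= w => <-.
apply/mnmP => i; case: (unliftP ord0 i) => [j ->|->].
  by rewrite (_ : lift _ _ = ord_max) ?bimonom1 //; apply/val_inj; rewrite [j]ord1.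
by rewrite bimonom0 addnK.
Qed.

Lemma bimonomX (K : comNzRingType) d k :
  'X_[K, bimonom d k] = 'X_ord0 ^+ (d - k) * 'X_ord_max ^+ k.
Proof. by rewrite mpolyXD -!mpolyXn. Qed.

Section BForms.
Variables (R : realType) (n : nat).
Implicit Type p : {mpoly R[i][2]}.

(* Forms of degree n+1 whose coefficients zeta_k = p@_(bimonom n.+1 k)        *)
(* satisfy the symmetry condition.                                            *)
Definition is_bform : {pred {mpoly R[i][2]}} :=
  fun p => (p \is n.+1.-homog) &&
    [forall k : 'I_n.+2,
      p@_(bimonom n.+1 k) == (-1) ^+ n * (p@_(bimonom n.+1 (n.+1 - k)))^*%C].

Lemma is_bformP p : reflect
  (exists zeta : nat -> R[i],
    (forall k, (k <= n.+1)%N -> zeta k = (-1) ^+ n * (zeta (n.+1 - k)%N)^*%C) /\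
    p = \sum_(k < n.+2) zeta k *: ('X_ord0 ^+ (n.+1 - k) * 'X_ord_max ^+ k))
  (is_bform p).
Proof.
have sumE (zeta : nat -> R[i]) m :
    (\sum_(k < n.+2) zeta k *:
        ('X_ord0 ^+ (n.+1 - k) * 'X_ord_max ^+ k : {mpoly R[i][2]}))@_m
    = if mdeg m == n.+1 then zeta (m ord_max) else 0.
  rewrite raddf_sum /=; case: eqP => [dm|dm].
    have lt : (m ord_max < n.+2)%N by rewrite ltnS -dm mdegE big_ord_recr /= leq_addl.
    rewrite (bigD1 (Ordinal lt)) //= -bimonomX bimonomK // mcoeffZ mcoeffX eqxx.
    rewrite mulr1 big1 ?addr0 // => k nk; rewrite -bimonomX mcoeffZ mcoeffX.
    case: eqP => [e|]; last by rewrite mulr0.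
    by move: nk; rewrite -val_eqE /= -e bimonom1 eqxx.
  apply: big1 => k _; rewrite -bimonomX mcoeffZ mcoeffX.
  case: eqP => [e|]; last by rewrite mulr0.
  by case: dm; rewrite -e mdeg_bimonom // -ltnS.
apply: (iffP andP) => [[hp /forallP sp]|[zeta [sz ->]]].
  exists (fun k => p@_(bimonom n.+1 k)); split=> [k kn|].
    exact: (eqP (sp (Ordinal (kn : (k < n.+2)%N)))).
  apply/mpolyP => m; rewrite (sumE (fun k => p@_(bimonom n.+1 k))); case: eqP => [dm|/eqP dm].
    by rewrite bimonomK.
  exact: dhomog_nemf_coeff hp dm.
split.
  apply/dhomogP => m; rewrite mcoeff_msupp sumE.
  by case: (mdeg m =P n.+1) => // _; rewrite eqxx.
apply/forallP => k; have kn : (k <= n.+1)%N by rewrite -ltnS.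
by rewrite !sumE !mdeg_bimonom ?leq_subr // eqxx !bimonom1 -sz.
Qed.

Lemma is_bform_zmod_closed : zmod_closed is_bform.
Proof.
split=> [|p q /andP[hp /forallP sp] /andP[hq /forallP sq]]; apply/andP; split.
- exact: rpred0.
- by apply/forallP => k; rewrite !mcoeff0 rmorph0 mulr0.
- exact: rpredB.
- apply/forallP => k; rewrite !mcoeffB rmorphB mulrBr.
  by rewrite -(eqP (sp k)) -(eqP (sq k)).
Qed.

HB.instance Definition _ :=
  GRing.isZmodClosed.Build {mpoly R[i][2]} is_bform is_bform_zmod_closed.

Lemma is_bformZ (a : R) p : p \in is_bform -> a%:C *: p \in is_bform.
Proof.
move=> /andP[hp /forallP sp]; apply/andP; split; first exact: rpredZ.
apply/forallP => k; rewrite !mcoeffZ rmorphM mulrCA -(eqP (sp k)) /=.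
by apply/eqP; congr (_ * _); exact/esym/conjc_real.
Qed.

Record bform := BForm { bform_val :> {mpoly R[i][2]}; _ : bform_val \in is_bform }.

HB.instance Definition _ := [isSub for bform_val].
HB.instance Definition _ := [Choice of bform by <:].
HB.instance Definition _ := [SubChoice_isSubZmodule of bform by <:].

Definition bform_scale (a : R) (p : bform) : bform :=
  BForm (is_bformZ a (valP p)).

Fact bform_scaleA a b (p : bform) :
  bform_scale a (bform_scale b p) = bform_scale (a * b) p.
Proof. by apply/val_inj; rewrite /= scalerA -rmorphM. Qed.

Fact bform_scale1 : left_id 1 bform_scale.
Proof. by move=> p; apply/val_inj; rewrite /= scale1r. Qed.

Fact bform_scaleDr : right_distributive bform_scale +%R.
Proof. by move=> a p q; apply/val_inj; rewrite /= scalerDr. Qed.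

Fact bform_scaleDl (p : bform) : {morph bform_scale^~ p : a b / a + b}.
Proof.
by move=> a b; apply/val_inj; rewrite /= rmorphD scalerDl.
Qed.

HB.instance Definition _ := GRing.Zmodule_isLmodule.Build R bform
  bform_scaleA bform_scale1 bform_scaleDr bform_scaleDl.

End BForms.

Definition Psi_eps (R : realType) (n : nat) : R[i] :=
  cexp ((pi : R)%:C * 'i%C / (2 * n.+1)%:R).

Definition Psi (R : realType) (n : nat) (p : {mpoly R[i][2]}) :
    {mpoly R[i][2]} :=
  let X : {mpoly R[i][2]} := 'X_ord0 in
  let Y : {mpoly R[i][2]} := 'X_ord_max in
  let eps := Psi_eps R n in
  if odd n then
    p \mPo [tuple eps *: (X + 'i%C *: Y); eps *: (X - 'i%C *: Y)]
  else
    p \mPo [tuple X + 'i%C *: Y; X - 'i%C *: Y].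

(* Main.v *)
(* A form p of degree n+1 lies in B_n iff conj(p)(T, U) = (-1)^n p(U, T), where
   conj acts on the coefficients.  Conjugation exchanges X + iY and X - iY, and
   by homogeneity q_n = w p_n(X + iY, X - iY), where w = 1 for n even and
   w = epsilon^(n+1) = i for n odd, so that conj(w) = (-1)^n w.  The two signs
   cancel and conj(q_n) = q_n, that is, q_n is real.
   The inverse substitution X = (T + U)/2, Y = (T - U)/(2i) sends a real form to
   one of B_n for the same reason, conjugation now amounting to T <-> U. *)
Require Import Defs.
From HB Require Import structures.
From mathcomp Require Import all_boot all_order all_algebra.
From mathcomp Require Import complex mpoly.
From mathcomp Require Import reals sequences exp trigo.

Set Implicit Arguments.
Unset Strict Implicit.
Unset Printing Implicit Defensive.

Import Order.TTheory GRing.Theory Num.Theory.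

Local Open Scope ring_scope.
Local Open Scope complex_scope.

(** * Substitution of linear forms into binary forms over a commutative ring *)

Section BinaryForms.
Variable K : comNzRingType.
Implicit Types (p A B : {mpoly K[2]}) (d : nat).

Local Notation X := ('X_ord0 : {mpoly K[2]}).
Local Notation Y := ('X_ord_max : {mpoly K[2]}).

Lemma comp_mpolyX0 A B : X \mPo [tuple A; B] = A.
Proof. by rewrite comp_mpolyXU. Qed.

Lemma comp_mpolyX1 A B : Y \mPo [tuple A; B] = B.
Proof. by rewrite comp_mpolyXU. Qed.

Lemma comp_bimonom d k A B :
  'X_[bimonom d k] \mPo [tuple A; B] = A ^+ (d - k) * B ^+ k.
Proof. by rewrite bimonomX rmorphM !rmorphXn /= comp_mpolyX0 comp_mpolyX1. Qed.

Lemma bimonom_exists (m : 'X_{1..2}) : exists d k, m = bimonom d k.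
Proof. by exists (mdeg m), (m ord_max); rewrite bimonomK. Qed.

(** Both sides are additive and homogeneous in [p], so monomials suffice, and there substitution of
    [C], [D] commutes with products and powers. *)
Lemma comp_mpolyA2 p A B (C D : {mpoly K[2]}) :
  (p \mPo [tuple A; B]) \mPo [tuple C; D] =
  p \mPo [tuple A \mPo [tuple C; D]; B \mPo [tuple C; D]].
Proof.
elim/mpolyind: p => [|c m p _ _ IH]; first by rewrite !comp_mpoly0.
have [d [k ->]] := bimonom_exists m.
rewrite !comp_mpolyD IH; congr (_ + _).
rewrite !comp_mpolyZ !comp_bimonom.
by rewrite rmorphM !rmorphXn.
Qed.

Lemma comp_mpoly_id2 p : p \mPo [tuple X; Y] = p.
Proof.
elim/mpolyind: p => [|c m p _ _ IH]; first by rewrite comp_mpoly0.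
have [d [k ->]] := bimonom_exists m.
by rewrite comp_mpolyD IH comp_mpolyZ comp_bimonom -bimonomX.
Qed.

(** A monomial [m] of degree [d] is determined by its exponent in [Y], so only the index
    [k = m ord_max] contributes to its coefficient. *)
Lemma dhomog_sum_bimonom d p : p \is d.-homog ->
  p = \sum_(k < d.+1) p@_(bimonom d k) *: 'X_[bimonom d k].
Proof.
move=> hp; apply/mpolyP => m; rewrite raddf_sum /=.
under eq_bigr do rewrite mcoeffZ mcoeffX.
have [dm|dm] := eqVneq (mdeg m) d; last first.
  rewrite (dhomog_nemf_coeff hp dm) big1 // => k _.
  case: eqP => [e|]; last by rewrite mulr0.
  by move: dm; rewrite -e mdeg_bimonom ?eqxx // -ltnS.
have lt : (m ord_max < d.+1)%N.
  by rewrite ltnS -dm mdegE big_ord_recr /= leq_addl.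
rewrite (bigD1 (Ordinal lt)) //= bimonomK // eqxx mulr1 big1 ?addr0 // => k.
rewrite -val_eqE /= => km; case: eqP => [e|]; last by rewrite mulr0.
by move: km; rewrite -e bimonom1 eqxx.
Qed.

Lemma comp_mpoly_sum_bimonom d p A B : p \is d.-homog ->
  p \mPo [tuple A; B] =
  \sum_(k < d.+1) p@_(bimonom d k) *: (A ^+ (d - k) * B ^+ k).
Proof.
move=> /dhomog_sum_bimonom {1}->; rewrite raddf_sum /=.
by apply: eq_bigr => k _; rewrite comp_mpolyZ comp_bimonom.
Qed.

Lemma comp_mpoly_homog d p A B :
  p \is d.-homog -> A \is 1.-homog -> B \is 1.-homog ->
  p \mPo [tuple A; B] \is d.-homog.
Proof.
move=> hp hA hB; rewrite (comp_mpoly_sum_bimonom _ _ hp).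
apply: rpred_sum => k _; apply: rpredZ.
have kd : (k <= d)%N by rewrite -ltnS.
have := dhomogM (dhomogMn (d - k) hA) (dhomogMn k hB).
by rewrite !mul1n subnK.
Qed.

(** Each monomial contributes [d - k] factors [c] from the first variable and [k] from the second.
    This is what extracts epsilon from the odd case as a single scalar. *)
Lemma comp_mpoly_scale d p c A B : p \is d.-homog ->
  p \mPo [tuple c *: A; c *: B] = c ^+ d *: (p \mPo [tuple A; B]).
Proof.
move=> hp; rewrite !(comp_mpoly_sum_bimonom _ _ hp) scaler_sumr.
apply: eq_bigr => k _; have kd : (k <= d)%N by rewrite -ltnS.
by rewrite !exprZn -scalerAl -scalerAr !scalerA -mulrA -exprD subnK // mulrC.
Qed.

(** Exchanging the variables reverses the list of coefficients, which lets the symmetry condition on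
    the [zeta_k] be written as one polynomial identity. *)
Lemma mcoeff_swap d p k : p \is d.-homog -> (k <= d)%N ->
  (p \mPo [tuple Y; X])@_(bimonom d k) = p@_(bimonom d (d - k)).
Proof.
move=> hp kd; rewrite (comp_mpoly_sum_bimonom _ _ hp) raddf_sum /=.
have E (j : 'I_d.+1) : Y ^+ (d - j) * X ^+ j = 'X_[bimonom d (d - j)].
  by rewrite bimonomX subKn 1?mulrC // -ltnS.
under eq_bigr => j _ do rewrite E mcoeffZ mcoeffX.
have lt : (d - k < d.+1)%N by rewrite ltnS leq_subr.
rewrite (bigD1 (Ordinal lt)) //= subKn // eqxx mulr1 big1 ?addr0 // => j.
rewrite -val_eqE /= => jk; case: eqP => [e|]; last by rewrite mulr0.
by move: jk; rewrite -(bimonom1 d k) -e bimonom1 subKn ?eqxx // -ltnS.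
Qed.

Lemma dhomogXi (i : 'I_2) : ('X_i : {mpoly K[2]}) \is 1.-homog.
Proof. by rewrite dhomogX; apply/eqP; exact: mdeg1. Qed.

End BinaryForms.

(** * Change of coefficients *)

Lemma map_mpoly_comp2 (K L : comNzRingType) (f : {rmorphism K -> L})
    (p A B : {mpoly K[2]}) : injective f ->
  map_mpoly f (p \mPo [tuple A; B]) =
  map_mpoly f p \mPo [tuple map_mpoly f A; map_mpoly f B].
Proof.
move=> inj_f; rewrite map_mpoly_comp //; congr comp_mpoly.
exact: val_inj.
Qed.

Lemma map_mpoly_inj (m : nat) (K L : nzRingType) (f : {additive K -> L}) :
  injective f -> injective (map_mpoly (n := m) f).
Proof.
move=> inj_f p q e; apply/mpolyP => k; apply: inj_f.
by rewrite -!mcoeff_map_mpoly e.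
Qed.

Lemma map_mpoly_homog (m d : nat) (K L : nzRingType) (f : {additive K -> L})
    (p : {mpoly K[m]}) : p \is d.-homog -> map_mpoly f p \is d.-homog.
Proof.
move=> hp; apply/dhomogP => k; rewrite mcoeff_msupp mcoeff_map_mpoly.
apply: contraNeq => dk.
by rewrite (dhomog_nemf_coeff hp dk) raddf0.
Qed.

(** * Complex conjugation and the root of unity epsilon *)

Section Complex.
Variable R : realType.
Local Notation C := R[i].

Lemma conjc_i : conjc ('i : C) = - 'i.
Proof. by apply/eqP; rewrite eq_complex /= oppr0 !eqxx. Qed.

Lemma i_neq0 : ('i : C) != 0.
Proof. by rewrite eq_complex /= oner_eq0 andbF. Qed.

Lemma de_Moivre (t : R) m :
  (cos t +i* sin t) ^+ m = cos (t *+ m) +i* sin (t *+ m).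
Proof.
elim: m => [|m IH]; first by rewrite expr0 mulr0n cos0 sin0.
rewrite exprS IH mulrS cosD sinD; simpc.
by congr (_ +i* _); rewrite addrC [sin t * _]mulrC mulrC.
Qed.

Lemma Psi_epsX n : Psi_eps R n ^+ n.+1 = 'i.
Proof.
(* The exponent is purely imaginary, so the real exponential in [cexp] is 1; de Moivre then raises
   the angle to [pi / 2]. *)
have -> : Psi_eps R n = cos (pi / (2 * n.+1)%:R) +i* sin (pi / (2 * n.+1)%:R).
  rewrite /Psi_eps /cexp -[(2 * n.+1)%:R](rmorph_nat (real_complex R)).
  rewrite mulrAC -fmorphV -rmorphM /=; simpc.
  by rewrite expR0 !mul1r.
rewrite de_Moivre.
have -> : pi / (2 * n.+1)%:R *+ n.+1 = pi / 2 :> R.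
  by rewrite natrM invfM mulrA -[LHS]mulr_natr divfK ?pnatr_eq0.
by rewrite cos_pihalf sin_pihalf.
Qed.

Lemma map_mpoly_conjc_fixed (m : nat) (p : {mpoly C[m]}) :
  map_mpoly conjc p = p ->
  map_mpoly (real_complex R) (map_mpoly (@complex.Re R) p) = p.
Proof.
move=> rp; apply/mpolyP => k; rewrite !mcoeff_map_mpoly.
have := congr1 (mcoeff k) rp; rewrite mcoeff_map_mpoly.
case: (p@_k) => a b /(congr1 (@complex.Im R)) /= bN.
(* Invariance under conjugation gives [- b = b] for the imaginary part, hence [b = 0]. *)
by congr (_ +i* _); apply/esym/eqP; rewrite -eqNr bN.
Qed.

Lemma map_mpoly_conjc_real (m : nat) (q : {mpoly R[m]}) :
  map_mpoly conjc (map_mpoly (real_complex R) q) = map_mpoly (real_complex R) q.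
Proof.
apply/mpolyP => k.
rewrite [LHS]mcoeff_map_mpoly.
have -> : (map_mpoly (real_complex R) q)@_k = (q@_k)%:C.
  exact: mcoeff_map_mpoly.
exact: conjc_real.
Qed.

Section Psi.
Variable n : nat.

Local Notation X := ('X_ord0 : {mpoly C[2]}).
Local Notation Y := ('X_ord_max : {mpoly C[2]}).
Local Notation L0 := (X + 'i *: Y).
Local Notation L1 := (X - 'i *: Y).
Local Notation M0 := ((2^-1 : C) *: (X + Y)).
Local Notation M1 := (((2 * 'i)^-1 : C) *: (X - Y)).

(** For odd [n] this is epsilon^(n+1); pulling it out reduces both parities to the same
    substitution. *)
Definition Psi_factor : C := if odd n then 'i else 1.

Local Notation w := Psi_factor.

Lemma Psi_factor_neq0 : w != 0.
Proof.
by rewrite /w; case: odd; rewrite ?i_neq0 ?oner_eq0.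
Qed.

Lemma conjc_Psi_factor : conjc w = (-1) ^+ n * w.
Proof.
rewrite /w -signr_odd; case: odd; first by rewrite conjc_i expr1 mulN1r.
by rewrite expr0 mul1r conjc1.
Qed.

Lemma conjc_Psi_factorV : conjc w^-1 = (-1) ^+ n * w^-1.
Proof. by rewrite conjc_inv conjc_Psi_factor invr_signM. Qed.

Lemma PsiE (p : {mpoly C[2]}) : p \is n.+1.-homog ->
  Psi n p = w *: (p \mPo [tuple L0; L1]).
Proof.
move=> hp; rewrite /Psi /w; case: odd; last by rewrite scale1r.
by rewrite (comp_mpoly_scale _ _ _ hp) Psi_epsX.
Qed.

(** The coefficientwise condition, conjugated: the sign is real, and the reversal of indices is the
    exchange of variables by [mcoeff_swap]. *)
Lemma bformE (p : {mpoly C[2]}) : p \is n.+1.-homog ->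
  (p \in @is_bform R n) =
  (map_mpoly conjc p == (-1) ^+ n *: (p \mPo [tuple Y; X])).
Proof.
move=> hp; rewrite unfold_in hp /=.
have hq : p \mPo [tuple Y; X] \is n.+1.-homog.
  by apply: comp_mpoly_homog; rewrite ?dhomogXi.
apply/forallP/eqP => [sp|ep k].
  apply/mpolyP => m; rewrite mcoeff_map_mpoly mcoeffZ /=.
  have [dm|dm] := eqVneq (mdeg m) n.+1; last first.
    by rewrite (dhomog_nemf_coeff hp dm) (dhomog_nemf_coeff hq dm) raddf0 mulr0.
  have kn : (m ord_max < n.+2)%N.
    by rewrite ltnS -dm mdegE big_ord_recr /= leq_addl.
  rewrite -(bimonomK dm) (mcoeff_swap hp kn) (eqP (sp (Ordinal kn))).
  by rewrite rmorphM rmorphXn rmorphN1 /= conjcK.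
have kn : (k <= n.+1)%N by rewrite -ltnS.
have := congr1 (mcoeff (bimonom n.+1 k)) ep.
rewrite mcoeff_map_mpoly mcoeffZ mcoeff_swap //.
move=> /(congr1 conjc); rewrite [LHS]conjcK => ->.
by rewrite rmorphM rmorphXn rmorphN1.
Qed.

(** * The two mutually inverse linear substitutions and their conjugates *)

Lemma dhomog_L0 : L0 \is 1.-homog.
Proof. by apply: rpredD; rewrite ?rpredZ ?dhomogXi. Qed.

Lemma dhomog_L1 : L1 \is 1.-homog.
Proof. by apply: rpredB; rewrite ?rpredZ ?dhomogXi. Qed.

Lemma dhomog_M0 : M0 \is 1.-homog.
Proof. by rewrite rpredZ // rpredD ?dhomogXi. Qed.

Lemma dhomog_M1 : M1 \is 1.-homog.
Proof. by rewrite rpredZ // rpredB ?dhomogXi. Qed.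

Lemma conj_L0 : map_mpoly conjc L0 = L1.
Proof.
by rewrite raddfD /= map_mpolyZ !map_mpolyX [X in X *: _]conjc_i scaleNr.
Qed.

Lemma conj_L1 : map_mpoly conjc L1 = L0.
Proof.
by rewrite raddfB /= map_mpolyZ !map_mpolyX [X in X *: _]conjc_i scaleNr opprK.
Qed.

Lemma conj_M0 : map_mpoly conjc M0 = M0.
Proof.
by rewrite map_mpolyZ [X in X *: _]conjc_inv conjc_nat raddfD /= !map_mpolyX.
Qed.

(** Both operations negate [M1]: conjugation through the factor ['i], the exchange through [X - Y].
    Since both fix [M0], they agree on the whole inverse substitution. *)
Lemma conj_M1 : map_mpoly conjc M1 = M1 \mPo [tuple Y; X].
Proof.
rewrite map_mpolyZ [X in X *: _]conjc_inv [X in X^-1]rmorphM.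
rewrite [X in X * _]conjc_nat [X in _ * X]conjc_i mulrN invrN scaleNr.
rewrite raddfB /= !map_mpolyX comp_mpolyZ comp_mpolyB.
by rewrite comp_mpolyX0 comp_mpolyX1 -scalerN opprB.
Qed.

Lemma swap_M0 : M0 \mPo [tuple Y; X] = M0.
Proof.
by rewrite comp_mpolyZ comp_mpolyD comp_mpolyX0 comp_mpolyX1 addrC.
Qed.

Lemma scale_half_double (p : {mpoly C[2]}) : (2^-1 : C) *: (p + p) = p.
Proof.
rewrite scalerDr -scalerDl -[_ + _]mulr2n -(mulr_natl 2^-1 2).
by rewrite mulfV ?pnatr_eq0 // scale1r.
Qed.

Lemma comp_M0_L : M0 \mPo [tuple L0; L1] = X.
Proof.
rewrite comp_mpolyZ comp_mpolyD comp_mpolyX0 comp_mpolyX1 addrCA addrK.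
exact: scale_half_double.
Qed.

Lemma comp_M1_L : M1 \mPo [tuple L0; L1] = Y.
Proof.
rewrite comp_mpolyZ comp_mpolyB comp_mpolyX0 comp_mpolyX1 opprB addrC subrKA.
rewrite invfM -scalerA scalerDr scale_half_double scalerA mulVf ?i_neq0 //.
exact: scale1r.
Qed.

Lemma i_scale_M1 : 'i *: M1 = (2^-1 : C) *: (X - Y).
Proof. by rewrite scalerA invfM mulrCA mulfV ?i_neq0 // mulr1. Qed.

Lemma comp_L0_M : L0 \mPo [tuple M0; M1] = X.
Proof.
rewrite comp_mpolyD comp_mpolyZ comp_mpolyX0 comp_mpolyX1 i_scale_M1 -scalerDr.
rewrite addrACA subrr addr0.
exact: scale_half_double.
Qed.

Lemma comp_L1_M : L1 \mPo [tuple M0; M1] = Y.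
Proof.
rewrite comp_mpolyB comp_mpolyZ comp_mpolyX0 comp_mpolyX1 i_scale_M1 -scalerBr.
rewrite opprB addrC subrKA.
exact: scale_half_double.
Qed.

Lemma Psi_real (p : {mpoly C[2]}) : p \is n.+1.-homog ->
  p \in @is_bform R n -> map_mpoly conjc (Psi n p) = Psi n p.
Proof.
move=> hp pB; rewrite PsiE // map_mpolyZ [X in X *: _]conjc_Psi_factor.
rewrite map_mpoly_comp2; last exact: (inv_inj (@conjcK R)).
have /eqP -> : map_mpoly conjc p == (-1) ^+ n *: (p \mPo [tuple Y; X]).
  by rewrite -bformE.
rewrite [map_mpoly _ L0]conj_L0 [map_mpoly _ L1]conj_L1.
rewrite comp_mpolyZ comp_mpolyA2 comp_mpolyX0 comp_mpolyX1.
(* One sign [(-1) ^+ n] comes from the factor [w], the other from the symmetry of [p]; their product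
   is 1. *)
by rewrite scalerA mulrAC -exprMn mulrNN mulr1 expr1n mul1r.
Qed.

Definition Psi_inv (q : {mpoly R[2]}) : {mpoly C[2]} :=
  w^-1 *: (map_mpoly (real_complex R) q \mPo [tuple M0; M1]).

Lemma Psi_inv_homog q : q \is n.+1.-homog -> Psi_inv q \is n.+1.-homog.
Proof.
move=> hq; apply: rpredZ.
apply: comp_mpoly_homog; rewrite ?dhomog_M0 ?dhomog_M1 //.
exact: map_mpoly_homog.
Qed.

Lemma Psi_inv_bform q : q \is n.+1.-homog -> Psi_inv q \in @is_bform R n.
Proof.
move=> hq; rewrite bformE ?Psi_inv_homog //; apply/eqP.
rewrite map_mpolyZ [X in X *: _]conjc_Psi_factorV.
rewrite map_mpoly_comp2; last exact: (inv_inj (@conjcK R)).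
rewrite map_mpoly_conjc_real [map_mpoly _ M0]conj_M0 [map_mpoly _ M1]conj_M1.
by rewrite [in RHS]comp_mpolyZ comp_mpolyA2 swap_M0 scalerA.
Qed.

Lemma Psi_invK q : q \is n.+1.-homog ->
  Psi n (Psi_inv q) = map_mpoly (real_complex R) q.
Proof.
move=> hq; rewrite PsiE ?Psi_inv_homog // comp_mpolyZ comp_mpolyA2.
rewrite comp_M0_L comp_M1_L comp_mpoly_id2.
by rewrite scalerA mulfV ?scale1r ?Psi_factor_neq0.
Qed.

(** Stated with the complex form [Psi n p] rather than through [Psi_inv], whose argument is real;
    the link is [Psi_formE]. *)
Lemma PsiK (p : {mpoly C[2]}) : p \is n.+1.-homog ->
  w^-1 *: (Psi n p \mPo [tuple M0; M1]) = p.
Proof.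
move=> hp; rewrite PsiE // comp_mpolyZ comp_mpolyA2.
rewrite comp_L0_M comp_L1_M comp_mpoly_id2.
by rewrite scalerA mulVf ?scale1r ?Psi_factor_neq0.
Qed.

(** * The real-linear isomorphism *)

Lemma bform_homog (p : bform R n) : bform_val p \is n.+1.-homog.
Proof. by case/andP: (valP p). Qed.

Lemma Psi_homog (p : {mpoly C[2]}) : p \is n.+1.-homog ->
  Psi n p \is n.+1.-homog.
Proof.
move=> hp; rewrite PsiE //; apply: rpredZ.
by apply: comp_mpoly_homog; rewrite ?dhomog_L0 ?dhomog_L1.
Qed.

(** Taking real parts of the coefficients yields a form over [R] at once; nothing is lost, because
    [Psi n p] is already real on B_n. *)
Definition Psi_form (p : bform R n) : dhomog 2 R n.+1 :=
  DHomog (map_mpoly_homog (@complex.Re R) (Psi_homog (bform_homog p))).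

Lemma Psi_formE (p : bform R n) :
  map_mpoly (real_complex R) (mpoly_of_dhomog (Psi_form p)) =
  Psi n (bform_val p).
Proof.
apply: map_mpoly_conjc_fixed; apply: Psi_real; first exact: bform_homog.
exact: valP.
Qed.

Lemma Psi_form_linear : linear Psi_form.
Proof.
(* Linearity is checked after embedding into complex polynomials, where [Psi_formE] removes the real
   parts. *)
move=> a p q; apply/val_inj; apply: (map_mpoly_inj (@complexI R)).
have lhsE : bform_val (a *: p + q) = a%:C *: bform_val p + bform_val q by [].
have rhsE : mpoly_of_dhomog (a *: Psi_form p + Psi_form q) =
    a *: mpoly_of_dhomog (Psi_form p) + mpoly_of_dhomog (Psi_form q) by [].
rewrite [LHS]Psi_formE PsiE ?bform_homog // lhsE [X in map_mpoly _ X]rhsE.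
rewrite [RHS]raddfD [X in _ = X + _]map_mpolyZ.
rewrite [X in _ = _ *: X + _]Psi_formE [X in _ = _ + X]Psi_formE.
rewrite !PsiE ?bform_homog // comp_mpolyD comp_mpolyZ scalerDr.
by rewrite !scalerA [a%:C * _]mulrC.
Qed.

HB.instance Definition _ :=
  GRing.isLinear.Build R (bform R n) (dhomog 2 R n.+1) _ Psi_form
    Psi_form_linear.

Lemma Psi_form_bij : bijective Psi_form.
Proof.
pose g (q : dhomog 2 R n.+1) : bform R n :=
  BForm (Psi_inv_bform (dhomog_is_dhomog q)).
exists g => [p|q]; apply/val_inj.
  transitivity (Psi_inv (mpoly_of_dhomog (Psi_form p))); first by [].
  rewrite /Psi_inv [map_mpoly _ _]Psi_formE.
  exact: PsiK (bform_homog p).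
apply: (map_mpoly_inj (@complexI R)).
rewrite [LHS]Psi_formE [LHS]Psi_invK //; exact: dhomog_is_dhomog.
Qed.

End Psi.
End Complex.

Theorem proposition2p7 (R : realType) (n : nat) (hn : (1 <= n)%N) :
  exists f : {linear bform R n -> dhomog 2 R n.+1},
    bijective f /\
    forall p : bform R n,
      map_mpoly (real_complex R) (mpoly_of_dhomog (f p))
      = Psi n (bform_val p).
Proof.
exists (@Psi_form R n); split; first exact: Psi_form_bij.
exact: Psi_formE.
Qed.
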